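(* Let $r\ge 2$ be an integer. The free metabelian group $\mathbb{M}_r$ of rank $r$ is not transitive self-similar.
   Context: **Free metabelian groups.** $\mathbb{M}_r=F_r/F_r''$, where $F_r$ is the free group of rank $r$ and $F_r''$ is its second derived subgroup. **Trees and states.** For an integer $m\ge 2$ and $Y=\{1,\dots,m\}$, let $\mathcal{T}_m$ be the regular one-rooted $m$-ary tree of finite words over $Y$ (root the empty word; $u$ is joined to $uy$ for every word $u$ and every $y\in Y$). Let $\mathcal{A}_m=\mathrm{Aut}(\mathcal{T}_m)$, acting on the right. Each $\alpha\in\mathcal{A}_m$ is written uniquely as $\alpha=(\alpha_1,\dots,\alpha_m)\sigma(\alpha)$ with $\alpha_i\in\mathcal{A}_m$ and $\sigma(\alpha)\in \mathrm{Perm}(Y)$, where $(yu)^\alpha=y^{\sigma(\alpha)}u^{\alpha_y}$ for $y\in Y$ and every word $u$. The set of states $Q(\alpha)$ is the smallest set containing $\alpha$ and closed under passing from $\beta$ to its components $\beta_1,\dots,\beta_m$. **Transitive self-similarity.** A subgroup $G\le\mathcal{A}_m$ is state-closed if $Q(\alpha)\subseteq G$ for all $\alpha\in G$. An abstract group $G$ is transitive self-similar if, for some integer $m\ge 2$, it has a faithful representation into $\mathcal{A}_m$ whose image is state-closed and acts transitively on the first level $Y$ of the tree. Equivalently (Nekrashevych–Sidki): there are a subgroup $H\le G$ of finite index $m\ge 2$ and a homomorphism $f:H\to G$ which is simple, meaning that the only subgroup $K\le H$ that is normal in $G$ and satisfies $K^f\le K$ is the trivial one. *)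

(* Defs.v *)
From HB Require Import structures.
From mathcomp Require Import all_boot.
From mathcomp Require Import generic_quotient.
From mathcomp Require Import boolp classical_sets.

Set Implicit Arguments.
Unset Strict Implicit.
Unset Printing Implicit Defensive.

Local Open Scope classical_set_scope.
Local Open Scope quotient_scope.
Local Open Scope group_scope.

(* The free group of rank r is realised on reduced words; the letter (i, true)
   stands for the generator x_i and (i, false) for its inverse. *)
Section ReducedWords.
Variable r : nat.

Local Notation letter := ('I_r * bool)%type.

Definition letter_inv (x : letter) : letter := (x.1, ~~ x.2).

Lemma letter_invK : involutive letter_inv.
Proof. by case=> i b; rewrite /letter_inv /= negbK. Qed.

Definition reduced (s : seq letter) : bool :=
  sorted (fun x y => y != letter_inv x) s.

Definition push (x : letter) (s : seq letter) : seq letter :=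
  if s is y :: s' then (if y == letter_inv x then s' else x :: s)
  else [:: x].

Definition reduce (s : seq letter) : seq letter := foldr push [::] s.

Definition word_inv (s : seq letter) : seq letter := rev (map letter_inv s).

Lemma push_reduced x s : reduced s -> reduced (push x s).
Proof.
case: s => [|y s] //= red_s; case: ifPn => [_|neq] /=.
  exact: path_sorted red_s.
by rewrite neq.
Qed.

Lemma foldr_push_reduced u s : reduced s -> reduced (foldr push s u).
Proof. by move=> red_s; elim: u => //= x u IHu; apply: push_reduced. Qed.

Lemma reduce_reduced s : reduced (reduce s).
Proof. exact: foldr_push_reduced. Qed.

Lemma reduce_id s : reduced s -> reduce s = s.
Proof.
elim: s => [//|x s IHs] red_s; rewrite /= -/(reduce s).
rewrite (IHs (path_sorted red_s)).
by case: s red_s {IHs} => [//|y s] /= /andP[/negbTE-> _].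
Qed.

Lemma push_invK x s : reduced s -> push x (push (letter_inv x) s) = s.
Proof.
case: s => [|y s] /=; first by rewrite eqxx.
rewrite letter_invK; case: (y =P x) => [->|_ _] /=; last by rewrite eqxx.
by case: s => //= z s /andP[/negbTE-> _].
Qed.

Lemma push_invVK x s : reduced s -> push (letter_inv x) (push x s) = s.
Proof. by move=> /(@push_invK (letter_inv x)); rewrite letter_invK. Qed.

Lemma foldr_push x s w : reduced w ->
  foldr push w (push x s) = push x (foldr push w s).
Proof.
move=> red_w; case: s => [|y s] //=; case: eqP => [->|//] /=.
by rewrite push_invK //; apply: foldr_push_reduced.
Qed.

Lemma foldr_reduce u w : reduced w ->
  foldr push w (reduce u) = foldr push w u.
Proof. by move=> red_w; elim: u => //= x u IHu; rewrite foldr_push ?IHu. Qed.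

Lemma reduce_catl u v : reduce (reduce u ++ v) = reduce (u ++ v).
Proof. by rewrite /reduce !foldr_cat foldr_reduce //; apply: reduce_reduced. Qed.

Lemma reduce_catr u v : reduce (u ++ reduce v) = reduce (u ++ v).
Proof.
by rewrite [LHS]foldr_cat [RHS]foldr_cat -!/(reduce _) reduce_id ?reduce_reduced.
Qed.

Lemma word_invK : involutive word_inv.
Proof.
move=> s; rewrite /word_inv map_rev revK -map_comp -[RHS]map_id.
by apply: eq_map => x /=; apply: letter_invK.
Qed.

Lemma word_inv_reduced s : reduced s -> reduced (word_inv s).
Proof.
rewrite /reduced /word_inv rev_sorted sorted_map; apply: sub_sorted => x y /=.
rewrite letter_invK; apply: contraNN => /eqP ->.
by [].
Qed.

Lemma foldr_word_inv u s : reduced s ->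
  foldr push (foldr push s u) (word_inv u) = s.
Proof.
move=> red_s; elim: u => //= x u IHu.
rewrite /word_inv /= rev_cons -cats1 foldr_cat /= push_invVK //.
exact: foldr_push_reduced.
Qed.

Lemma reduce_invl u : reduce (word_inv u ++ u) = [::].
Proof. by rewrite /reduce foldr_cat foldr_word_inv. Qed.

Lemma reduce_invr u : reduce (u ++ word_inv u) = [::].
Proof. by rewrite -{1}[u]word_invK reduce_invl. Qed.

Record free_group : Type :=
  FreeGroup { free_word :> seq letter; free_wordP : reduced free_word }.
HB.instance Definition _ := [isSub for free_word].
HB.instance Definition _ := [Choice of free_group by <:].

Definition free_one : free_group := @FreeGroup [::] isT.
Definition free_mul (u v : free_group) : free_group :=
  FreeGroup (reduce_reduced (free_word u ++ free_word v)).
Definition free_inv (u : free_group) : free_group :=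
  FreeGroup (word_inv_reduced (free_wordP u)).

Lemma free_mulA : associative free_mul.
Proof.
by move=> u v w; apply: val_inj; rewrite /= reduce_catl reduce_catr catA.
Qed.
Lemma free_mul1 : left_id free_one free_mul.
Proof. by move=> u; apply: val_inj; rewrite /= reduce_id ?free_wordP. Qed.
Lemma free_mulr1 : right_id free_one free_mul.
Proof. by move=> u; apply: val_inj; rewrite /= cats0 reduce_id ?free_wordP. Qed.
Lemma free_mulV : left_inverse free_one free_inv free_mul.
Proof. by move=> u; apply: val_inj; apply: reduce_invl. Qed.
Lemma free_mulrV : right_inverse free_one free_inv free_mul.
Proof. by move=> u; apply: val_inj; apply: reduce_invr. Qed.

HB.instance Definition _ := isGroup.Build free_group
  free_mulA free_mul1 free_mulr1 free_mulV free_mulrV.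

End ReducedWords.

Section Subgroups.
Variable G : groupType.
Implicit Types H A : set G.

Definition is_subgroup H : Prop :=
  H 1 /\ forall x y, H x -> H y -> H (x / y).

Definition is_normal H : Prop :=
  is_subgroup H /\ forall x y, H x -> H (x ^ y).

Definition derived H : set G :=
  smallest is_subgroup [set [~ x, y] | x in H & y in H].

Lemma is_subgroup_smallest A : is_subgroup (smallest is_subgroup A).
Proof.
split=> [H [[H1 _] _] //|x y Hx Hy H subgH].
by case: (subgH) => -[_ HF] _; apply: HF; [apply: Hx | apply: Hy].
Qed.

Lemma derived_normal H : is_normal H -> is_normal (derived H).
Proof.
move=> [_ HJ]; split=> [|x y Dx]; first exact: is_subgroup_smallest.
apply: (Dx [set z | derived H (z ^ y)]); split=> /=.
  have [D1 DF] := is_subgroup_smallest [set [~ x, y] | x in H & y in H].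
  split=> [|a b Da Db] /=; first by rewrite conj1g.
  by rewrite conjMg conjVg; apply: DF.
move=> _ [a Ha [b Hb <-]] /= K [_]; apply.
by exists (a ^ y); [apply: HJ | exists (b ^ y); [apply: HJ | rewrite conjRg]].
Qed.

Lemma setT_normal : is_normal [set: G].
Proof. by []. Qed.

Record normal_subgroup : Type :=
  NormalSubgroup { normal_set :> G -> Prop; normal_setP : is_normal normal_set }.

End Subgroups.

Section Quotient.
Variables (G : groupType) (N : normal_subgroup G).

Lemma normal1 : N 1.
Proof. by case: (normal_setP N) => -[]. Qed.
Lemma normalF x y : N x -> N y -> N (x / y).
Proof. by case: (normal_setP N) => -[_ NF] _; apply: NF. Qed.
Lemma normalJ x y : N x -> N (x ^ y).
Proof. by case: (normal_setP N) => _; apply. Qed.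
Lemma normalV x : N x -> N x^-1.
Proof. by move=> Nx; rewrite -div1g; apply: normalF => //; apply: normal1. Qed.
Lemma normalM x y : N x -> N y -> N (x * y).
Proof. by move=> Nx Ny; rewrite -[y]invgK; apply: normalF => //; apply: normalV. Qed.

Definition same_coset (x y : G) : bool := `[< N (x^-1 * y) >].

Lemma same_coset_equiv : equiv_class_of same_coset.
Proof.
split=> [x|x y|y x z].
- by apply/asboolP; rewrite mulVg; apply: normal1.
- by apply/idP/idP => /asboolP/normalV Nxy; apply/asboolP; move: Nxy; rewrite invgM invgK.
- move=> /asboolP Nxy /asboolP Nyz; apply/asboolP.
  by rewrite -(mulgK y x^-1) -mulgA; apply: normalM.
Qed.

Canonical same_coset_eq_rel := EquivRelPack same_coset_equiv.

Definition quotient_group : Type := {eq_quot same_coset}.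
HB.instance Definition _ := Choice.on quotient_group.
HB.instance Definition _ := EqQuotient.on quotient_group.

Definition coset (x : G) : quotient_group := \pi_quotient_group x.

Definition quotient_mul (a b : quotient_group) : quotient_group :=
  coset (repr a * repr b).
Definition quotient_inv (a : quotient_group) : quotient_group :=
  coset (repr a)^-1.

Lemma coset_eqP x y : coset x = coset y <-> N (x^-1 * y).
Proof. by split=> [/eqP|Nxy]; [rewrite eqmodE => /asboolP
  | apply/eqP; rewrite eqmodE; apply/asboolP]. Qed.

Lemma coset_repr a : coset (repr a) = a.
Proof. exact: reprK. Qed.

Lemma coset_mul x y : quotient_mul (coset x) (coset y) = coset (x * y).
Proof.
rewrite /quotient_mul; apply/coset_eqP.
set x' := repr _; set y' := repr _.
have Nx : N (x'^-1 * x) by apply/coset_eqP; rewrite coset_repr.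
have Ny : N (y'^-1 * y) by apply/coset_eqP; rewrite coset_repr.
suff -> : (x' * y')^-1 * (x * y) = (x'^-1 * x) ^ y' * (y'^-1 * y).
  by apply: normalM => //; apply: normalJ.
by rewrite conjgE invgM !mulgA mulgK.
Qed.

Lemma coset_inv x : quotient_inv (coset x) = coset x^-1.
Proof.
rewrite /quotient_inv; apply/coset_eqP; set x' := repr _.
have Nx : N (x^-1 * x') by apply/coset_eqP; rewrite coset_repr.
suff -> : x'^-1^-1 * x^-1 = (x^-1 * x') ^ x^-1 by apply: normalJ.
by rewrite conjgE !invgK !mulgA mulgV mul1g.
Qed.

Lemma quotient_mulA : associative quotient_mul.
Proof.
by move=> a b c; rewrite -[a]coset_repr -[b]coset_repr -[c]coset_repr
  !coset_mul mulgA.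
Qed.
Lemma quotient_mul1 : left_id (coset 1) quotient_mul.
Proof. by move=> a; rewrite -[a]coset_repr coset_mul mul1g. Qed.
Lemma quotient_mulr1 : right_id (coset 1) quotient_mul.
Proof. by move=> a; rewrite -[a]coset_repr coset_mul mulg1. Qed.
Lemma quotient_mulV : left_inverse (coset 1) quotient_inv quotient_mul.
Proof. by move=> a; rewrite -[a]coset_repr coset_inv coset_mul mulVg. Qed.
Lemma quotient_mulrV : right_inverse (coset 1) quotient_inv quotient_mul.
Proof. by move=> a; rewrite -[a]coset_repr coset_inv coset_mul mulgV. Qed.

HB.instance Definition _ := isGroup.Build quotient_group
  quotient_mulA quotient_mul1 quotient_mulr1 quotient_mulV quotient_mulrV.

Lemma cosetM : {morph coset : x y / x * y}.
Proof. by move=> x y; rewrite -coset_mul. Qed.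
Lemma coset_monoid_morphism : monoid_morphism coset.
Proof. by split=> // x y; rewrite cosetM. Qed.
HB.instance Definition _ :=
  isUMagmaMorphism.Build G quotient_group coset coset_monoid_morphism.

End Quotient.

Definition second_derived (G : groupType) : normal_subgroup G :=
  NormalSubgroup (derived_normal (derived_normal (@setT_normal G))).

Definition free_metabelian (r : nat) : groupType :=
  quotient_group (second_derived (free_group r)).

Section Tree.
Variable m : nat.

(* The alphabet Y = {1, ..., m} is represented by 'I_m = {0, ..., m - 1}. *)
Definition tree_adj (u v : seq 'I_m) : bool :=
  [exists y, (v == rcons u y) || (u == rcons v y)].

Record tree_aut : Type := TreeAut {
  aut_fun :> seq 'I_m -> seq 'I_m;
  aut_finv : seq 'I_m -> seq 'I_m;
  aut_funK : cancel aut_fun aut_finv;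
  aut_finvK : cancel aut_finv aut_fun;
  aut_root : aut_fun [::] = [::];
  aut_adj : forall u v, tree_adj (aut_fun u) (aut_fun v) = tree_adj u v }.

HB.instance Definition _ := gen_eqMixin tree_aut.
HB.instance Definition _ := gen_choiceMixin tree_aut.

Lemma tree_autP (a b : tree_aut) : a =1 b -> a = b.
Proof.
case: a => f f' fK f'K f0 fA; case: b => g g' gK g'K g0 gA /= efg.
have ef : f = g by apply/funext.
have ef' : f' = g' by apply/funext => u; rewrite -{1}[u]g'K -efg fK.
case: _ / ef in gK g'K g0 gA *; case: _ / ef' in gK g'K *.
by congr TreeAut; apply: Prop_irrelevance.
Qed.

Definition aut1 : tree_aut :=
  @TreeAut id id (fun _ => erefl) (fun _ => erefl) erefl (fun _ _ => erefl).

Section Ops.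
Variables a b : tree_aut.

Lemma autM_root : (b \o a) [::] = [::].
Proof. by rewrite /= !aut_root. Qed.
Lemma autM_adj u v : tree_adj ((b \o a) u) ((b \o a) v) = tree_adj u v.
Proof. by rewrite /= !aut_adj. Qed.

(* Automorphisms act on the right: a * b is a followed by b. *)
Definition autM : tree_aut :=
  TreeAut (can_comp (@aut_funK b) (@aut_funK a))
    (can_comp (@aut_finvK a) (@aut_finvK b)) autM_root autM_adj.

Lemma autV_root : aut_finv a [::] = [::].
Proof. by rewrite -{1}(aut_root a) aut_funK. Qed.
Lemma autV_adj u v : tree_adj (aut_finv a u) (aut_finv a v) = tree_adj u v.
Proof. by rewrite -(aut_adj a) !aut_finvK. Qed.

Definition autV : tree_aut :=
  TreeAut (@aut_finvK a) (@aut_funK a) autV_root autV_adj.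

End Ops.

Lemma autMA : associative autM.
Proof. by move=> a b c; apply: tree_autP. Qed.
Lemma autM1 : left_id aut1 autM.
Proof. by move=> a; apply: tree_autP. Qed.
Lemma autMr1 : right_id aut1 autM.
Proof. by move=> a; apply: tree_autP. Qed.
Lemma autMV : left_inverse aut1 autV autM.
Proof. by move=> a; apply: tree_autP => u; apply: aut_finvK. Qed.
Lemma autMrV : right_inverse aut1 autV autM.
Proof. by move=> a; apply: tree_autP => u; apply: aut_funK. Qed.

HB.instance Definition _ := isGroup.Build tree_aut
  autMA autM1 autMr1 autMV autMrV.

Lemma aut_rcons (a : tree_aut) u y : exists z, a (rcons u y) = rcons (a u) z.
Proof.
have adj v x : tree_adj (a v) (a (rcons v x)).
  by rewrite aut_adj; apply/existsP; exists x; rewrite eqxx.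
elim/last_ind: u y => [|u x IHu] y.
  have /existsP[z /orP[/eqP ->|]] := adj [::] y; first by exists z.
  by rewrite aut_root; case: (a _).
have /existsP[z /orP[/eqP ->|/eqP eux]] := adj (rcons u x) y; first by exists z.
have [t eu] := IHu x; move: eux; rewrite eu => /rcons_inj[/(can_inj (@aut_funK a))].
move=> /(congr1 size); rewrite !size_rcons => /eqP.
by rewrite -addn2 -{1}[size u]addn0 eqn_add2l.
Qed.

(* sigma(a), read off the action of a on words of length one. *)
Definition aut_perm (a : tree_aut) (y : 'I_m) : 'I_m := head y (a [:: y]).

(* aut_cons: (y u)^a = y^sigma(a) u^(a_y), with a_y acting by state_fun a y;
   state a y below is a_y as an automorphism. *)
Definition state_fun (a : tree_aut) (y : 'I_m) (u : seq 'I_m) : seq 'I_m :=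
  behead (a (y :: u)).

Lemma aut_cons (a : tree_aut) y u :
  a (y :: u) = aut_perm a y :: state_fun a y u.
Proof.
rewrite /state_fun; elim/last_ind: u => [|u x IHu].
  have [z] := aut_rcons a [::] y; rewrite /= aut_root /= /aut_perm => e.
  by rewrite e.
by rewrite -rcons_cons; have [z ->] := aut_rcons a (y :: u) x; rewrite IHu.
Qed.

Lemma aut_permK a : cancel (aut_perm a) (aut_perm a^-1).
Proof.
move=> y; have := aut_funK a [:: y].
by rewrite aut_cons -[aut_finv a]/(aut_fun a^-1) aut_cons => -[].
Qed.

Lemma state_funK a y : cancel (state_fun a y) (state_fun a^-1 (aut_perm a y)).
Proof.
move=> u; have := aut_funK a (y :: u).
by rewrite aut_cons -[aut_finv a]/(aut_fun a^-1) aut_cons => -[].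
Qed.

Lemma state_funVK a y : cancel (state_fun a^-1 (aut_perm a y)) (state_fun a y).
Proof.
move=> u; have := state_funK a^-1 (aut_perm a y) u.
by rewrite aut_permK invgK.
Qed.

Lemma state_root a y : state_fun a y [::] = [::].
Proof.
by rewrite /state_fun; have [z /= ->] := aut_rcons a [::] y; rewrite aut_root.
Qed.

Lemma tree_adj_cons y u v : tree_adj (y :: u) (y :: v) = tree_adj u v.
Proof. by apply: eq_existsb => z; rewrite !rcons_cons !eqseq_cons !eqxx. Qed.

Lemma state_adj a y u v :
  tree_adj (state_fun a y u) (state_fun a y v) = tree_adj u v.
Proof.
by rewrite -(tree_adj_cons (aut_perm a y)) -!aut_cons aut_adj tree_adj_cons.
Qed.

Definition state (a : tree_aut) (y : 'I_m) : tree_aut :=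
  TreeAut (@state_funK a y) (@state_funVK a y) (state_root a y) (state_adj a y).

Definition states (a : tree_aut) : set tree_aut :=
  smallest (fun S => forall b y, S b -> S (state b y)) [set a].

Definition state_closed (G : set tree_aut) : Prop :=
  forall a, G a -> states a `<=` G.

Definition level1_transitive (G : set tree_aut) : Prop :=
  forall x y : 'I_m, exists2 a, G a & aut_perm a x = y.

End Tree.

Definition transitive_self_similar (G : groupType) : Prop :=
  exists m : nat, (2 <= m)%N /\
  exists phi : {multiplicative G -> tree_aut m},
    [/\ injective phi, state_closed (range phi) & level1_transitive (range phi)].

(* Main.v *)
Require Import Defs.
From mathcomp Require Import all_boot all_algebra zify.
From mathcomp Require Import boolp classical_sets.

(** Write M for the free metabelian group and A for its derived subgroup.  A
    transitive self-similar representation gives a simple virtual endomorphism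
    f : H -> M, where H is the stabiliser of a first-level vertex
    ([self_similar_endo]); the task is to find a non-trivial conjugation
    invariant f-invariant subset of H.  Besides the torsion-freeness of A and
    M/A, one property of M is used: for y outside A, an element x of A such
    that [x, y] is an e-th power in A is itself an e-th power in A.  For
    e = 0 this says that no non-trivial element of A commutes with y.

    Let e be such that e-th powers fix the first level.
    - Suppose f(b) lies outside A for some b in H and A.  Then f kills [a, h]
      for all h in H and a in H and A, because the image is in A and commutes
      with f(b).  If instead f(H) lies in A, then f kills [a, h] because A is
      abelian.  In both cases fix h in H outside A; the commutators [a, h]
      with a in A fixing the first level form a normal subgroup killed by f.
    - Otherwise f maps the elements of A in H into A, and f(h) is outside A for
      some h in H.  For a in A, f([a, h^e]) lies in A and its e-th power is
      [f(a^e), f(h^e)], so f(a^e) is an e-th power in A: the subgroup of e-th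
      powers of A is f-invariant.
    This is [not_self_similar].

    The divisibility property comes from the Cayley graph of Z^r.  A word traces
    a walk in this graph, and it counts every edge algebraically; this is the
    Magnus embedding, the counts being the coefficients of the Fox derivatives.
    An element of A is a closed walk, and writing it as a product of loops, one
    for every edge crossed, shows that it is an e-th power in A as soon as all
    its counts are divisible by e ([closed_root]).  If [x, y] is an e-th power,
    the counts of x modulo e are invariant under translation by the non-zero
    image of y in Z^r; being finitely supported they vanish modulo e
    ([flow_period_dvd]). *)

Set Implicit Arguments.
Unset Strict Implicit.
Unset Printing Implicit Defensive.

(** * Closure properties of subgroups *)

Section SubgroupClosure.
Local Open Scope group_scope.
Variables (G : groupType) (A : set G).
Hypothesis A_subgroup : is_subgroup A.

Lemma subgroup1 : A 1. Proof. by case: A_subgroup. Qed.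

Lemma subgroupV x : A x -> A x^-1.
Proof. by case: A_subgroup => A1 AF Ax; rewrite -div1g; apply: AF. Qed.

Lemma subgroupM x y : A x -> A y -> A (x * y).
Proof.
case: A_subgroup => _ AF Ax Ay; rewrite -[y]invgK; apply: AF => //.
exact: subgroupV.
Qed.

Lemma subgroupX x n : A x -> A (x ^+ n).
Proof.
move=> Ax; elim: n => [|n IHn]; first exact: subgroup1.
by rewrite expgS; apply: subgroupM.
Qed.

End SubgroupClosure.

(** * Virtual endomorphisms of self-similar groups *)

Section VirtualEndomorphism.
Local Open Scope classical_set_scope.
Local Open Scope group_scope.

(** The subgroup H plays the role of the stabiliser of a vertex and N that of
    the stabiliser of the whole first level, whose quotient has exponent
    dividing e.  Simplicity is required of conjugation invariant subsets rather
    than of normal subgroups: the two conditions are equivalent, since such a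
    subset generates an f-invariant normal subgroup inside H. *)
Record simple_virtual_endo (G : groupType) (e : nat) (N H : set G)
    (f : G -> G) : Prop := SimpleVirtualEndo {
  endo_dom : is_subgroup H;
  endo_core_dom : N `<=` H;
  endo_core : is_normal N;
  endo_exp : forall x, N (x ^+ e);
  endoM : forall x y, H x -> H y -> f (x * y) = f x * f y;
  endo_simple : forall K : set G, (forall x y, K x -> K (x ^ y)) ->
    K `<=` H -> (forall x, K x -> K (f x)) -> forall x, K x -> x = 1 }.

Lemma iter_factorial (T : finType) (g : T -> T) (y : T) :
  injective g -> iter (#|T|)`! g y = y.
Proof.
move=> inj_g; have /dvdnP[k ->] : order g y %| (#|T|)`!.
  by rewrite dvdn_fact // order_gt0 max_card.
by elim: k => // k IHk; rewrite mulSn iterD IHk iter_order.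
Qed.

Section Action.
Variable m : nat.
Implicit Types (a b : tree_aut m) (y : 'I_m).

Lemma aut_perm_state1 y :
  aut_perm (1 : tree_aut m) y = y /\ state (1 : tree_aut m) y = 1.
Proof. by split=> //; apply: tree_autP. Qed.

Lemma aut_permM a b y : aut_perm (a * b) y = aut_perm b (aut_perm a y).
Proof.
have: (a * b) [:: y] = b (a [:: y]) by [].
by rewrite !aut_cons => -[].
Qed.

Lemma stateM a b y : state (a * b) y = state a y * state b (aut_perm a y).
Proof.
apply: tree_autP => u; have: (a * b) (y :: u) = b (a (y :: u)) by [].
by rewrite !aut_cons => -[].
Qed.

Lemma aut_permX a n y : aut_perm (a ^+ n) y = iter n (aut_perm a) y.
Proof.
elim: n => [|n IHn] /=; first by have [] := aut_perm_state1 y.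
by rewrite expgSr aut_permM IHn.
Qed.

Lemma aut_permV a y : aut_perm a^-1 (aut_perm a y) = y.
Proof. exact: aut_permK. Qed.

Lemma stateV a y : state a^-1 (aut_perm a y) = (state a y)^-1.
Proof.
apply: (mulgI (state a y)); rewrite -stateM !mulgV.
by have [] := aut_perm_state1 y.
Qed.

End Action.

(** For g in the stabiliser of the vertex y0, f(g) is the element represented
    by the state of g at y0.  For simplicity, let K be conjugation invariant
    and f-invariant inside the stabiliser of y0.  By transitivity every
    first-level vertex is the image of y0 by some g, so conjugating by g shows
    that K fixes the first level and that the states of elements of K are again
    in K; hence K acts trivially on the tree. *)
Lemma self_similar_endo (G : groupType) : transitive_self_similar G ->
  exists e N H f, 0 < e /\ @simple_virtual_endo G e N H f.
Proof.
move=> [m [m_gt1 [phi [phi_inj phi_closed phi_trans]]]].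
have y0 : 'I_m by exists 0; apply: ltnW.
have phi1 : phi 1 = 1 by apply: (mulgI (phi 1)); rewrite -gmulfM !mulg1.
have phiV g : phi g^-1 = (phi g)^-1.
  by apply: (mulgI (phi g)); rewrite -gmulfM !mulgV.
have phiX g n : phi (g ^+ n) = phi g ^+ n.
  by elim: n => // n IHn; rewrite !expgS gmulfM IHn.
have phi_state g y : exists h, phi h = state (phi g) y.
  have [||h _ <-] := phi_closed (phi g) _ (state (phi g) y).
  - by exists g.
  - by move=> S [SS Sg]; apply: SS; apply: Sg.
  - by exists h.
pose f g := projT1 (cid (phi_state g y0)).
have fE g : phi (f g) = state (phi g) y0 by rewrite /f; case: cid.
have p1 y : aut_perm (phi 1) y = y.
  by rewrite phi1; have [] := aut_perm_state1 y.
have pM g h y :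
    aut_perm (phi (g * h)) y = aut_perm (phi h) (aut_perm (phi g) y).
  by rewrite gmulfM aut_permM.
have pV g y : aut_perm (phi g^-1) (aut_perm (phi g) y) = y.
  by rewrite phiV aut_permV.
have pfixV g y : aut_perm (phi g) y = y -> aut_perm (phi g^-1) y = y.
  by move=> fix_y; rewrite -{1}fix_y pV.
exists m`!, [set g | forall y, aut_perm (phi g) y = y],
  [set g | aut_perm (phi g) y0 = y0], f.
split; first exact: fact_gt0.
split=> /=.
- split=> [|x y Hx Hy] /=; first exact: p1.
  by rewrite pM Hx pfixV.
- by move=> x; apply.
- split; first split=> //= x y Nx Ny z.
    by rewrite pM Nx pfixV.
  by move=> x g /= Nx y; rewrite conjgE !pM Nx -!pM mulVg p1.
- move=> x y; rewrite phiX aut_permX.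
  rewrite -[in m`!](card_ord m) iter_factorial //.
  exact: can_inj (aut_permK _).
- move=> x y Hx Hy; apply: phi_inj.
  by rewrite fE !gmulfM stateM !fE Hx.
move=> K KJ KH Kf k Kk.
have fix_level1 x y : K x -> aut_perm (phi x) y = y.
  move=> Kx; have [_ [g _ <-] <-] := phi_trans y0 y.
  have /KH/= := KJ _ g^-1 Kx; rewrite conjgE invgK !pM => e.
  by rewrite -[LHS](pV g^-1) invgK e.
have stateK x y : K x -> exists2 x', K x' & phi x' = state (phi x) y.
  move=> Kx; have [_ [g _ <-] <-] := phi_trans y0 y.
  have [h hE] := phi_state g y0.
  have -> : x = (x ^ g^-1) ^ g by rewrite -conjgM mulVg conjg1.
  move: (x ^ g^-1) (KJ _ g^-1 Kx) => z Kz.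
  exists (f z ^ h); first by apply/KJ/Kf.
  rewrite !conjgE !gmulfM !phiV !stateM aut_permV stateV fix_level1 //.
  by rewrite fE hE.
apply: phi_inj; rewrite phi1; apply: tree_autP => u.
elim: u k Kk => [|y u IHu] k Kk; first by rewrite aut_root.
have [k' Kk' k'E] := stateK k y Kk.
rewrite aut_cons fix_level1 // -[state_fun _ _ _]/(state (phi k) y u) -k'E.
by rewrite IHu.
Qed.

End VirtualEndomorphism.

(** * An obstruction to self-similarity *)

Section Obstruction.
Local Open Scope classical_set_scope.
Local Open Scope group_scope.

(** The last field is a purity condition on A as a module over G/A: no y - 1
    with y non-trivial creates e-divisibility in A.  For e = 0 it says that
    the centraliser of any y outside A meets A trivially. *)
Record pure_abelian_part (G : groupType) (A : set G) : Prop := {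
  part_normal : is_normal A;
  part_comm : forall x y, A [~ x, y];
  part_abelian : forall x y, A x -> A y -> commute x y;
  part_quotient_tf : forall x n, 0 < n -> A (x ^+ n) -> A x;
  part_tf : forall x n, 0 < n -> A x -> x ^+ n = 1 -> x = 1;
  part_pure : forall x y a e, A x -> ~ A y -> A a -> [~ x, y] = a ^+ e ->
    exists2 b, A b & x = b ^+ e }.

Lemma not_self_similar (G : groupType) (A : set G) :
  pure_abelian_part A -> (exists2 x, A x & x <> 1) -> ~ A = setT ->
  ~ transitive_self_similar G.
Proof.
move=> [[Asub AJ] AR Aab QT AT Ap] [a0 Aa0 a0n1] AnT.
move=> /self_similar_endo[e [N [H [f [e_gt0 [Hsub NH [Nsub NJ] Ne fM simp]]]]]].
have [A1 AV AM AX] := And4 (subgroup1 Asub) (subgroupV Asub) (subgroupM Asub)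
  (subgroupX Asub).
have [H1 HV HM] := And3 (subgroup1 Hsub) (subgroupV Hsub) (subgroupM Hsub).
have cent_free x y : A x -> ~ A y -> [~ x, y] = 1 -> x = 1.
  by move=> Ax Ay /(Ap _ _ _ 0 Ax Ay A1)[b _]; rewrite expg0.
have f1 : f 1 = 1 by apply: (mulgI (f 1)); rewrite -fM // !mulg1.
have fV x : H x -> f x^-1 = (f x)^-1.
  by move=> Hx; apply: (mulgI (f x)); rewrite -fM ?mulgV //; apply: HV.
have fX x n : H x -> H (x ^+ n) /\ f (x ^+ n) = f x ^+ n.
  move=> Hx; elim: n => [|n [IHn En]] //.
  by rewrite !expgS fM // En; split=> //; apply: HM.
have fR x y : H x -> H y -> H [~ x, y] /\ f [~ x, y] = [~ f x, f y].
  move=> Hx Hy; have Hx' := HV _ Hx; have Hy' := HV _ Hy.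
  have Hxy := HM _ _ Hx Hy; have Hc := HM _ _ Hy' Hxy.
  rewrite /commg /conjg; split; first exact: HM.
  by rewrite !fM ?fV.
have [g0 Ag0] : exists x, ~ A x.
  by apply: contra_notP AnT => /forallNP AnT; apply/seteqP; split=> // x _;
    apply: contrapT; apply: AnT.
have NAX x : ~ A x -> ~ A (x ^+ e) by move=> Ax Axe; apply/Ax/(QT _ e).
pose h0 := g0 ^+ e; have Ah0 : ~ A h0 by apply: NAX.
have Hh0 : H h0 by apply/NH/Ne.
(* The elements [a, h] with a in A and N form a conjugation invariant set, as
   conjugating h only multiplies it by an element of A. *)
have kills h : H h -> ~ A h ->
    ~ (forall a, A a -> H a -> f [~ a, h] = 1).
  move=> Hh Ah fah.
  have nz : [~ a0 ^+ e, h] <> 1.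
    move=> /(cent_free _ _ (AX _ _ Aa0) Ah) /(AT _ _ e_gt0 Aa0).
    exact: a0n1.
  apply: nz; apply: (simp [set x | exists2 a, A a /\ N a & x = [~ a, h]]).
  - move=> _ g [a [Aa Na] ->].
    exists (a ^ g); first by split; [apply: AJ | apply: NJ].
    have [Aag Ac] : A (a ^ g) /\ A [~ h, g] by split; [apply: AJ | apply: AR].
    rewrite conjRg; have -> : h ^ g = h * [~ h, g] by rewrite commgEl mulVKg.
    rewrite /commg; congr (_ * _); rewrite conjgM.
    apply/conjg_fixP/commgP; apply: Aab => //; exact: AJ.
  - by move=> _ [a [Aa Na] ->] /=; have [] := fR a h (NH _ Na) Hh.
  - move=> _ [a [Aa Na] ->] /=; exists 1; first by split; last apply: subgroup1.
    by rewrite fah ?comm1g //; apply: NH.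
  - by exists (a0 ^+ e) => //; split=> //; apply: AX.
(* If f b lies outside A, then f [a, h0] is both in A and centralised by f b. *)
have [fA|] := pselect (forall a, A a -> H a -> A (f a)); last first.
  move=> /existsNP[b /not_implyP[Ab /not_implyP[Hb Afb]]].
  apply: (kills h0) => // a Aa Ha.
  have [Hah fah] := fR a h0 Ha Hh0; have [Hc fc] := fR _ b Hah Hb.
  apply: (cent_free _ (f b)) => //; first by rewrite fah.
  rewrite -fc; have /commgP/eqP-> : commute [~ a, h0] b by apply: Aab.
  exact: f1.
have [fH|] := pselect (forall h, H h -> A (f h)).
  apply: (kills h0) => // a Aa Ha; have [_ ->] := fR a h0 Ha Hh0.
  by apply/eqP/commgP/Aab; apply: fH.
(* There remains the case where the e-th powers of A are f-invariant. *)
move=> /existsNP[h /not_implyP[Hh Afh]].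
apply: a0n1; apply: (AT _ e) => //.
apply: (simp [set x | exists2 a, A a & x = a ^+ e]); last by exists a0.
- by move=> _ g [a Aa ->]; exists (a ^ g); [apply: AJ | rewrite conjXg].
- by move=> _ [a Aa ->]; apply/NH/Ne.
move=> _ [a Aa ->].
have Hae : H (a ^+ e) by apply/NH/Ne.
(* The element a itself need not be in H, but [a, h ^+ e] is, since h ^+ e is in
   the normal subgroup N; this lets the exponent e be taken out of f. *)
pose h' := h ^+ e; have Nh' : N h' by apply: Ne.
have Hh' := NH _ Nh'.
have Hc : H [~ a, h'].
  apply: NH; rewrite commgEr; apply: (subgroupM Nsub) => //.
  exact/NJ/(subgroupV Nsub).
have Ec : [~ a ^+ e, h'] = [~ a, h'] ^+ e.
  rewrite /commg expgMn -?conjXg ?expVgn //.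
  by apply: Aab; [apply: AV|apply: AJ].
have [_ Ef] := fR _ h' Hae Hh'.
apply: (Ap _ (f h') (f [~ a, h'])).
- by apply: fA => //; apply: AX.
- by have [_ ->] := fX h e Hh; apply: NAX.
- exact: fA.
- by rewrite -Ef Ec; have [] := fX [~ a, h'] e Hc.
Qed.

End Obstruction.

(** * Products over signed crossings of edges *)

Section BalancedProduct.
Local Open Scope group_scope.
Variables (E : eqType) (G : groupType) (A : set G) (t : E -> G).
Hypothesis A_subgroup : is_subgroup A.
Hypothesis A_abelian : forall x y, A x -> A y -> commute x y.
Hypothesis At : forall x, A (t x).
Implicit Types l : seq (E * bool).

Definition net (x : E) l : int :=
  ((count_mem (x, true) l)%:Z - (count_mem (x, false) l)%:Z)%R.

Definition traverse (z : E * bool) : G := if z.2 then t z.1 else (t z.1)^-1.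

Definition traverse_prod l : G := \prod_(z <- l) traverse z.

Let A1 := subgroup1 A_subgroup.
Let AV := subgroupV A_subgroup.
Let AM := subgroupM A_subgroup.
Let AX := subgroupX A_subgroup.

Lemma traverse_prod_split x l : traverse_prod l =
  t x ^+ count_mem (x, true) l * t x ^- count_mem (x, false) l
    * traverse_prod [seq z <- l | z.1 != x].
Proof.
rewrite /traverse_prod; elim: l => [|[y b] l IHl] /=.
  by rewrite !big_nil !expg0 invg1 !mulg1.
rewrite big_cons IHl !xpair_eqE; case: (eqVneq y x) => [->|y_x] /=.
  rewrite /traverse; case: b => /=; first by rewrite expgS !mulgA.
  rewrite add0n expgS invgM !mulgA; congr (_ * _).
  rewrite -[in RHS]mulgA -expVgn -expgSr expgS mulgA expVgn; congr (_ * _).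
  exact/commute_sym/commuteV/commute_sym/commuteX/commute_refl.
rewrite !add0n big_cons !mulgA; congr (_ * _); rewrite -[LHS]mulgA.
apply: A_abelian; last by apply: AM; [|apply: AV]; apply: AX.
by rewrite /traverse; case: (b) => //=; apply: AV.
Qed.

(** In an abelian group the product only depends on the net counts, by
    collecting the crossings of one edge at a time; a common divisor of the
    net counts then factors out as an exponent. *)
Lemma balanced_prod (e : nat) l : (forall x, (e %| net x l)%Z) ->
  exists2 b, A b & traverse_prod l = b ^+ e.
Proof.
move: {2}(size l) (leqnn (size l)) => n; elim: n l => [|n IHn] [|[x c] l] //.
1,2: by exists 1; [exact: A1 | rewrite expg1n /traverse_prod big_nil].
move: ((x, c) :: l) (mem_head (x, c) l) => {}l xl le_ln el.
have [b Ab bE] : exists2 b, A b &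
    traverse_prod [seq z <- l | z.1 != x] = b ^+ e.
  apply: IHn.
    rewrite size_filter -ltnS; apply: leq_trans le_ln.
    rewrite -(count_predC (fun z => z.1 != x) l) -addn1 leq_add2l -has_count.
    by apply/hasP; exists (x, c) => //=; rewrite eqxx.
  have cE y d : count_mem (y, d) [seq z <- l | z.1 != x] =
      if y == x then 0 else count_mem (y, d) l.
    rewrite count_filter; case: eqP => [->|/eqP y_x].
      rewrite -[RHS](count_pred0 l); apply: eq_count => -[z c'] /=.
      by rewrite xpair_eqE; case: eqP; rewrite ?andbF.
    apply: eq_count => -[z c'] /=; rewrite xpair_eqE.
    by case: (eqVneq z y) => //= ->; rewrite y_x andbT.
  by move=> y; rewrite /net !cE; case: eqP => // _; apply: el.
have /dvdzP[k] := el x; rewrite /net => kE.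
have [b' Ab' b'E] : exists2 b', A b' & t x ^+ count_mem (x, true) l
    * t x ^- count_mem (x, false) l = b' ^+ e.
  set m1 := count_mem _ l in kE *; set m2 := count_mem _ l in kE *.
  have [le21|/ltnW le12] := leqP m2 m1.
    exists (t x ^+ `|k|); first exact: AX.
    by rewrite -expgnFr // -expgnA; congr (_ ^+ _); nia.
  exists (t x ^- `|k|); first exact/AV/AX.
  rewrite -[LHS]invgK invgF -expgnFr // expVgn -expgnA.
  by congr (_ ^- _); nia.
exists (b' * b); first exact: AM.
by rewrite (traverse_prod_split x) bE b'E expgMn //; apply: A_abelian.
Qed.

End BalancedProduct.

(** * Walks in the Cayley graph of the free abelian group *)

Section Routes.
Import GRing.Theory.
Variable r : nat.
Local Notation letter := ('I_r * bool)%type.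
Local Notation Q := {ffun 'I_r -> int}.
Implicit Types (x : letter) (s u v : seq letter) (p q : Q).
Local Open Scope ring_scope.

Definition step x : Q :=
  [ffun k => if k == x.1 then (if x.2 then 1 else -1) else 0].

Definition displacement s : Q := \sum_(x <- s) step x.

(** The edge (p, i) joins p to p + e_i; the letter x_i^-1 read at q crosses,
    backwards, the edge that starts at q - e_i. *)
Definition crossed q x : (Q * 'I_r) * bool :=
  ((if x.2 then q else q + step x, x.1), x.2).

Fixpoint route q s : seq ((Q * 'I_r) * bool) :=
  if s is x :: s' then crossed q x :: route (q + step x) s' else [::].

(** The integer [flow s p i] is the coefficient of p in the Fox derivative of s
    with respect to x_i, projected to the group ring of Z^r. *)
Definition flow s (p : Q) (i : 'I_r) : int := net (p, i) (route 0 s).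

Lemma step_inv x : step (letter_inv x) = - step x.
Proof.
apply/ffunP=> k; rewrite !ffunE; case: x => i [] /=; case: (k == i) => //;
  by rewrite ?oppr0 ?opprK.
Qed.

Lemma displacement_cons x s : displacement (x :: s) = step x + displacement s.
Proof. exact: big_cons. Qed.

Lemma displacement_cat s u :
  displacement (s ++ u) = displacement s + displacement u.
Proof. exact: big_cat. Qed.

Lemma displacement_count s i :
  displacement s i = (count_mem (i, true) s)%:Z - (count_mem (i, false) s)%:Z.
Proof.
elim: s => [|[j b] s IHs]; first by rewrite /displacement big_nil ffunE.
rewrite displacement_cons !ffunE IHs /= !xpair_eqE [i == j]eq_sym.
case: (j == i) => //=; case: b => //=; lia.
Qed.

Lemma route_cat q s u :
  route q (s ++ u) = route q s ++ route (q + displacement s) u.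
Proof.
elim: s q => [|x s IHs] q /=; first by rewrite /displacement big_nil addr0.
by rewrite IHs displacement_cons addrA.
Qed.

Lemma net_cons (E : eqType) (e : E) z l :
  net e (z :: l) = net e [:: z] + net e l.
Proof. by rewrite /net /=; lia. Qed.

Lemma net_cat (E : eqType) (e : E) l l' : net e (l ++ l') = net e l + net e l'.
Proof. by rewrite /net !count_cat; lia. Qed.

Lemma net_cancel (E : eqType) (e a : E) b : net e [:: (a, b); (a, ~~ b)] = 0.
Proof. by rewrite /net /= !xpair_eqE; case: (_ == _); case: b. Qed.

Lemma net_route q s p i : net (p, i) (route q s) = flow s (p - q) i.
Proof.
rewrite /flow; elim: s q p => [//|x s IHs] q p /=.
rewrite net_cons [RHS]net_cons (IHs (q + step x)) (IHs (0 + step x)).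
rewrite [0 + step x]add0r opprD [p + (_ - _)]addrA; congr (_ + _).
have shift (d : Q) : (q + d == p) = (0 + d == p - q).
  by rewrite add0r -[d == _](inj_eq (addrI q)) [q + (p - q)]addrC subrK.
rewrite /net /= !xpair_eqE; case: x => j [] /=; last by rewrite shift.
by rewrite -[q in LHS]addr0 shift addr0.
Qed.

Lemma flow_cat s u p i :
  flow (s ++ u) p i = flow s p i + flow u (p - displacement s) i.
Proof. by rewrite {1}/flow route_cat net_cat !net_route subr0 add0r. Qed.

Lemma displacement_nil : displacement [::] = 0.
Proof. exact: big_nil. Qed.

Lemma displacement_letter x : displacement [:: x] = step x.
Proof. exact: big_seq1. Qed.

Lemma flow_nil p i : flow [::] p i = 0.
Proof. by []. Qed.

Lemma flow_letter i p j : flow [:: (i, true)] p j = ((p == 0) && (j == i))%:Z.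
Proof.
rewrite /flow /net /= !xpair_eqE [0 == p]eq_sym [i == j]eq_sym andbT andbF.
by rewrite !addn0 subr0.
Qed.

Lemma crossed_inv q x :
  crossed (q + step x) (letter_inv x) = ((crossed q x).1, ~~ x.2).
Proof.
by case: x => j [] //; rewrite /crossed /= step_inv addrK.
Qed.

Lemma flow_cancel x p i : flow [:: x; letter_inv x] p i = 0.
Proof.
rewrite /flow /= crossed_inv; case: x => j b; exact: net_cancel.
Qed.

Lemma displacement_reduce s : displacement (reduce s) = displacement s.
Proof.
elim: s => //= x s IHs; rewrite displacement_cons -IHs.
case: (reduce s) => [|y u] /=; first by rewrite displacement_cons.
case: eqP => [->|_]; last by rewrite displacement_cons.
by rewrite displacement_cons step_inv addrA subrr add0r.
Qed.

Lemma flow_reduce s p i : flow (reduce s) p i = flow s p i.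
Proof.
elim: s p => //= x s IHs p; rewrite -cat1s flow_cat -IHs -flow_cat cat1s.
case: (reduce s) => [|y u] //=; case: eqP => [->|_] //.
rewrite -[x :: _]/([:: x; letter_inv x] ++ u) flow_cat flow_cancel add0r.
by rewrite !displacement_cons displacement_nil step_inv addr0 subrr subr0.
Qed.

(** The words x_1^q_1 ... x_r^q_r are coset representatives for the kernel of
    the displacement. *)
Definition normal_word q : seq letter :=
  flatten [seq nseq `|q i|%N (i, 0 <= q i) | i <- enum 'I_r].

Lemma displacement_nseq n x : displacement (nseq n x) = step x *+ n.
Proof.
elim: n => [|n IHn]; first exact: displacement_nil.
by rewrite displacement_cons IHn mulrS.
Qed.

Lemma displacement_normal_word q : displacement (normal_word q) = q.
Proof.
have -> : displacement (normal_word q) =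
    \sum_i step (i, 0 <= q i) *+ `|q i|%N.
  rewrite /displacement big_flatten big_map big_enum.
  by apply: eq_bigr => i _; rewrite -displacement_nseq.
apply/ffunP=> k; rewrite sum_ffunE (bigD1 k) //= big1 => [|j jk];
  rewrite ffunMnE ffunE /=.
  by rewrite eqxx addr0; case: ifP => q0; lia.
by rewrite eq_sym (negbTE jk) mul0rn.
Qed.

Lemma flow_supp s p i :
  flow s p i != 0 -> (p, i) \in [seq z.1 | z <- route 0 s].
Proof.
apply: contraR => notin; rewrite /flow /net.
suff cE b : count_mem ((p, i), b) (route 0 s) = 0%N by rewrite !cE.
by apply/count_memPn; apply: contra notin => /(map_f fst).
Qed.

(** Otherwise the flow would be non-zero at all the points p + n q, which are
    infinitely many, while a word crosses finitely many edges. *)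
Lemma flow_period_dvd s p q i (e : int) : q != 0 ->
  (forall p', (e %| flow s (p' + q) i - flow s p' i)%Z) -> (e %| flow s p i)%Z.
Proof.
move=> q0 per; apply: contraT => ndv.
have ndvn n : ~~ (e %| flow s (p + q *+ n) i)%Z.
  elim: n => [|n IHn]; first by rewrite addr0.
  rewrite mulrSr addrA; apply: contra IHn => d.
  rewrite -[flow s (p + q *+ n) i](subKr (flow s (p + q *+ n + q) i)).
  exact/rpredB/per.
(* One point more than the number of crossings. *)
pose l := [seq (p + q *+ n, i) | n <- iota 0 (size (route 0 s)).+1].
have : (size l <= size [seq z.1 | z <- route 0%R s])%N.
  apply: uniq_leq_size.
    rewrite map_inj_uniq ?iota_uniq // => a b [/addrI].
    have [k qk] : exists k, q k != 0.
      by apply/existsP; apply: contraR q0 => /existsPn q0; apply/eqP/ffunP => k;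
         rewrite ffunE; apply/eqP; have := q0 k; rewrite negbK.
    by move=> /ffunP/(_ k); rewrite !ffunMnE; apply: Num.Theory.mulrIn.
  move=> _ /mapP[n _ ->]; apply: flow_supp; apply: contraNneq (ndvn n) => ->.
  exact: dvdz0.
by rewrite !size_map size_iota ltnn.
Qed.

End Routes.

(** * Circulations in the free metabelian group *)

Section FreeMetabelian.
Import GRing.Theory.
Variable r : nat.
Local Notation F := (free_group r).
Local Notation M := (free_metabelian r).
Local Notation letter := ('I_r * bool)%type.
Local Notation Q := {ffun 'I_r -> int}.
Implicit Types (x : letter) (s u v : seq letter) (p q : Q) (g h : M).
Local Open Scope classical_set_scope.
Local Open Scope group_scope.

Definition free_eval s : F := FreeGroup (reduce_reduced s).

Definition eval s : M := coset (second_derived F) (free_eval s).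

Lemma free_evalM s u : free_eval (s ++ u) = free_eval s * free_eval u.
Proof. by apply: val_inj; rewrite /= reduce_catl reduce_catr. Qed.

Lemma free_evalK (w : F) : free_eval w = w.
Proof. by apply: val_inj; rewrite /= reduce_id // free_wordP. Qed.

Lemma evalM s u : eval (s ++ u) = eval s * eval u.
Proof. by rewrite /eval free_evalM cosetM. Qed.

Definition word_of g : seq letter := repr g.

Lemma word_ofK g : eval (word_of g) = g.
Proof. by rewrite /eval free_evalK coset_repr. Qed.

Lemma free_eval_nil : free_eval [::] = 1.
Proof. exact: val_inj. Qed.

Lemma eval_nil : eval [::] = 1.
Proof. by rewrite /eval free_eval_nil gmulf1. Qed.

Lemma free_eval_inv x : free_eval [:: letter_inv x] = (free_eval [:: x])^-1.
Proof.
apply: (mulgI (free_eval [:: x])); rewrite mulgV -free_evalM.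
by apply: val_inj; rewrite /= eqxx.
Qed.

Lemma eval_inv x : eval [:: letter_inv x] = (eval [:: x])^-1.
Proof. by rewrite /eval free_eval_inv gmulfV. Qed.

Lemma free_displacementM (a b : F) :
  displacement (a * b) = (displacement a + displacement b)%R.
Proof. by rewrite displacement_reduce displacement_cat. Qed.

Lemma free_displacementV (a : F) : displacement a^-1 = (- displacement a)%R.
Proof.
by apply/eqP; rewrite -addr_eq0 -free_displacementM mulVg displacement_nil.
Qed.

Lemma free_flowM (a b : F) p i :
  flow (a * b) p i = (flow a p i + flow b (p - displacement a) i)%R.
Proof. by rewrite flow_reduce flow_cat. Qed.

Lemma free_flowV (a : F) p i :
  flow a^-1 p i = (- flow a (p + displacement a) i)%R.
Proof.
have := free_flowM a^-1 a p i; rewrite mulVg free_displacementV opprK flow_nil.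
by move=> /esym/eqP; rewrite addr_eq0 => /eqP.
Qed.

Lemma derived_displacement (w : F) :
  derived [set: F] w -> displacement w = 0%R.
Proof.
move=> Dw; apply: (Dw [set a : F | displacement a = 0%R]).
split=> [|c [a _ [b _ <-]]].
  split=> [|a b a0 b0]; first exact: displacement_nil.
  apply: etrans (free_displacementM a b^-1) _.
  by rewrite free_displacementV a0 b0 subr0.
apply: etrans (free_displacementM _ _) _.
by rewrite !(free_displacementM, free_displacementV) addrCA addKr addNr.
Qed.

(** On closed walks the flow is a homomorphism to an abelian group, so it
    vanishes on commutators of closed walks. *)
Lemma second_derived_flow (w : F) : second_derived F w ->
  displacement w = 0%R /\ forall p i, flow w p i = 0%R.
Proof.
move=> D2w; apply: (D2w [set a : F | displacement a = 0%R /\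
  forall p i, flow a p i = 0%R]).
split=> [|c [a Da [b Db <-]]].
  split=> [|a b [a0 fa] [b0 fb]]; first by split=> //; exact: displacement_nil.
  split=> [|p i].
    apply: etrans (free_displacementM a b^-1) _.
    by rewrite free_displacementV a0 b0 subr0.
  apply: etrans (free_flowM a b^-1 p i) _.
  by rewrite free_flowV fa fb oppr0 addr0.
have [a0 b0] := (derived_displacement Da, derived_displacement Db).
split=> [|p i].
  apply: etrans (free_displacementM _ _) _.
  by rewrite !(free_displacementM, free_displacementV) a0 b0 !(addr0, oppr0).
apply: etrans (free_flowM _ _ p i) _.
rewrite !(free_flowM, free_flowV) !(free_displacementM, free_displacementV).
by rewrite a0 b0 !(subr0, oppr0, addr0); lia.
Qed.

(** If the displacement of x s is zero, then x^-1 occurs in s, and x u x^-1 v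
    is congruent to the shorter word u v modulo commutators. *)
Lemma displacement0_derived s :
  displacement s = 0%R -> derived [set: F] (free_eval s).
Proof.
have [Dsub DJ] := derived_normal (@setT_normal F).
have DM := subgroupM Dsub.
have DR a b : derived [set: F] [~ a, b].
  by move=> K [_]; apply; exists a => //; exists b.
move: {2}(size s) (leqnn (size s)) => n; elim: n s => [|n IHn] [|x s] //.
1,2: by rewrite free_eval_nil; case: Dsub.
move=> /= le_sn d0.
have xs : letter_inv x \in s.
  have /ffunP/(_ x.1) := d0.
  rewrite displacement_count ffunE -has_pred1 has_count.
  rewrite -[letter_inv x]/(x.1, ~~ x.2); case: {d0} x => i [] /=.
    rewrite !xpair_eqE eqxx /=.
    by case: (posnP (count_mem (i, false) s)) => // ->; lia.
  rewrite !xpair_eqE eqxx /=.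
  by case: (posnP (count_mem (i, true) s)) => // ->; lia.
case/splitPr: xs le_sn d0 => u v le_uv d0.
have -> : free_eval (x :: u ++ letter_inv x :: v) =
    free_eval (u ++ v) * [~ free_eval u, (free_eval [:: x])^-1] ^ free_eval v.
  rewrite -cat1s -[letter_inv x :: v]cat1s !free_evalM free_eval_inv.
  by rewrite /commg /conjg !invgK !mulgA mulgK mulgV mul1g.
apply: DM; last by apply: DJ; apply: DR.
apply: IHn; first by move: le_uv; rewrite !size_cat /=; lia.
move: d0; rewrite displacement_cons !displacement_cat displacement_cons.
rewrite step_inv.
by rewrite [X in (step x + X)%R]addrCA addNKr.
Qed.

Lemma eval_eq s u : eval s = eval u ->
  displacement s = displacement u /\ flow s =2 flow u.
Proof.
move=> /coset_eqP Nw; have [] := second_derived_flow Nw.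
move: (free_displacementM (free_eval s) ((free_eval s)^-1 * free_eval u)).
move=> dE d0; rewrite d0 addr0 mulVKg in dE.
move: dE; rewrite !displacement_reduce => dE f0; split=> // p i.
have := free_flowM (free_eval s) ((free_eval s)^-1 * free_eval u) p i.
by rewrite f0 addr0 mulVKg !flow_reduce.
Qed.

(** The displacement and the flow of words factor through the free metabelian
    group by [eval_eq], so any representative computes them. *)
Definition shift g : Q := displacement (word_of g).
Definition circulation g p i : int := flow (word_of g) p i.

Lemma shift_eval s : shift (eval s) = displacement s.
Proof. by have [] := eval_eq (word_ofK (eval s)). Qed.

Lemma circulation_eval s p i : circulation (eval s) p i = flow s p i.
Proof. by have [_ e] := eval_eq (word_ofK (eval s)); exact: e. Qed.

Lemma shiftM g h : shift (g * h) = (shift g + shift h)%R.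
Proof.
by rewrite -[g]word_ofK -[h]word_ofK -evalM !shift_eval displacement_cat.
Qed.

Lemma circulationM g h p i : circulation (g * h) p i =
  (circulation g p i + circulation h (p - shift g) i)%R.
Proof.
rewrite -[g]word_ofK -[h]word_ofK -evalM !circulation_eval shift_eval.
exact: flow_cat.
Qed.

Lemma shift1 : shift 1 = 0%R.
Proof. by rewrite -eval_nil shift_eval displacement_nil. Qed.

Lemma circulation1 p i : circulation 1 p i = 0%R.
Proof. by rewrite -eval_nil circulation_eval. Qed.

Lemma shiftV g : shift g^-1 = (- shift g)%R.
Proof. by apply/eqP; rewrite -addr_eq0 -shiftM mulVg shift1. Qed.

Lemma circulationV g p i :
  circulation g^-1 p i = (- circulation g (p + shift g) i)%R.
Proof.
have := circulationM g^-1 g p i; rewrite mulVg shiftV opprK circulation1.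
by move=> /esym/eqP; rewrite addr_eq0 => /eqP.
Qed.

Lemma shiftX g n : shift (g ^+ n) = (shift g *+ n)%R.
Proof.
by elim: n => [|n IHn]; rewrite ?expg0 ?shift1 // expgS shiftM IHn mulrS.
Qed.

(** This is the derived subgroup of the free metabelian group, described by the
    walks it consists of. *)
Definition closed_walks : set M := [set g | shift g = 0%R].

Lemma circulationX g n p i : closed_walks g ->
  circulation (g ^+ n) p i = (circulation g p i *+ n)%R.
Proof.
rewrite /closed_walks /= => g0; elim: n => [|n IHn]; first exact: circulation1.
by rewrite expgS circulationM g0 subr0 IHn mulrS.
Qed.

Lemma shiftR g h : shift [~ g, h] = 0%R.
Proof. by rewrite /commg /conjg !(shiftM, shiftV) addrCA addKr addNr. Qed.

Lemma circulationR g h p i : closed_walks g ->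
  circulation [~ g, h] p i =
  (circulation g (p + shift h) i - circulation g p i)%R.
Proof.
rewrite /closed_walks /= => g0; rewrite /commg /conjg.
rewrite !(circulationM, circulationV) !(shiftM, shiftV) g0.
by rewrite !(oppr0, subr0, addr0, opprK, addrK); lia.
Qed.

Lemma closed_subgroup : is_subgroup closed_walks.
Proof.
split=> [|g h]; first exact: shift1.
by rewrite /closed_walks /= shiftM shiftV => -> ->; rewrite subr0.
Qed.

Lemma closed_normal : is_normal closed_walks.
Proof.
split; first exact: closed_subgroup.
move=> g h; rewrite /closed_walks /= /conjg !shiftM shiftV => ->.
by rewrite add0r addNr.
Qed.

Lemma closed_abelian g h : closed_walks g -> closed_walks h -> commute g h.
Proof.
rewrite -[g]word_ofK -[h]word_ofK /closed_walks /= !shift_eval => g0 h0.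
apply/commgP/eqP; rewrite -eval_nil /eval -gmulfR free_eval_nil.
apply/coset_eqP; rewrite mulg1 invgR => K [_]; apply.
exists (free_eval (word_of h)); first exact: displacement0_derived.
by exists (free_eval (word_of g)); first exact: displacement0_derived.
Qed.

(** The Schreier generator of the edge: go from 0 to its origin, cross it and
    come back to 0, along the chosen representatives. *)
Definition edge_loop (e : Q * 'I_r) : M :=
  eval (normal_word e.1) * eval [:: (e.2, true)]
    / eval (normal_word (e.1 + step (e.2, true))%R).

Lemma closed_edge_loop e : closed_walks (edge_loop e).
Proof.
rewrite /closed_walks /edge_loop /= !(shiftM, shiftV) !shift_eval.
by rewrite !displacement_normal_word displacement_letter subrr.
Qed.

(** Each letter contributes the loop of the edge it crosses, and the return of
    one loop cancels the departure of the next. *)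
Lemma telescope q s :
  eval (normal_word q) * eval s / eval (normal_word (q + displacement s)%R) =
  traverse_prod edge_loop (route q s).
Proof.
elim: s q => [|x s IHs] q /=.
  by rewrite displacement_nil addr0 eval_nil mulg1 mulgV /traverse_prod big_nil.
rewrite /traverse_prod big_cons -/(traverse_prod edge_loop _) -IHs.
rewrite displacement_cons addrA.
have -> : traverse edge_loop (crossed q x) =
    eval (normal_word q) * eval [:: x] / eval (normal_word (q + step x)%R).
  rewrite /traverse /edge_loop; case: x => i [] //=.
  rewrite -[(i, true)]/(letter_inv (i, false)) step_inv addrK eval_inv.
  by rewrite !invgM !invgK mulgA.
by rewrite -cat1s evalM !mulgA mulgVK.
Qed.

(** A closed walk is the product of the loops of the edges it crosses, up to
    conjugation by the closed walk of [normal_word 0], which commutes with it.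
    With e = 0 this is the faithfulness of the Magnus embedding on the derived
    subgroup. *)
Lemma closed_root (e : nat) g : closed_walks g ->
  (forall p i, (e %| circulation g p i)%Z) ->
  exists2 h, closed_walks h & g = h ^+ e.
Proof.
move=> g0 dvd_g.
have [|h h0 hE] := @balanced_prod _ _ _ edge_loop closed_subgroup closed_abelian
    closed_edge_loop e (route 0%R (word_of g)).
  by case=> p i; apply: dvd_g.
exists h => //; rewrite -hE -telescope word_ofK.
have -> : displacement (word_of g) = 0%R by [].
rewrite addr0 -mulgA closed_abelian ?mulgVK //.
  by rewrite /closed_walks /= shift_eval displacement_normal_word.
rewrite /closed_walks /= shiftM shiftV g0 add0r shift_eval.
by rewrite displacement_normal_word oppr0.
Qed.

Lemma closed_pure : pure_abelian_part closed_walks.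
Proof.
have tf g n : 0 < n -> closed_walks g -> g ^+ n = 1 -> g = 1.
  move=> n_gt0 g0 gn1; have [|h _ ->] := @closed_root 0 g g0; last exact: expg0.
  move=> p i; have := circulationX n p i g0.
  rewrite gn1 circulation1 dvd0z => /esym/eqP.
  by rewrite Num.Theory.mulrn_eq0 gtn_eqF.
split.
- exact: closed_normal.
- exact: shiftR.
- exact: closed_abelian.
- move=> g n n_gt0; rewrite /closed_walks /= shiftX => /ffunP gn0.
  apply/ffunP=> k.
  move: (gn0 k); rewrite ffunMnE ffunE => /eqP.
  by rewrite Num.Theory.mulrn_eq0 gtn_eqF // => /eqP.
- exact: tf.
move=> g h a e g0 h0 a0 ghE; apply: closed_root => // p i.
apply: (@flow_period_dvd _ _ _ (shift h)); first exact/eqP.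
move=> p'; rewrite -/(circulation g _ _) -/(circulation g _ _).
rewrite -circulationR // ghE circulationX // -mulr_natr; apply: dvdz_mull.
by rewrite natz.
Qed.

Lemma shift_letter i : shift (eval [:: (i, true)]) i = 1%R.
Proof. by rewrite shift_eval displacement_letter ffunE eqxx. Qed.

Lemma closed_proper (i : 'I_r) : closed_walks <> setT.
Proof.
move=> cT; have : [set: M] (eval [:: (i, true)]) by [].
by rewrite -cT => /ffunP/(_ i); rewrite shift_letter ffunE.
Qed.

(** The word x_i x_j crosses the edge (0, i), while x_j x_i does not. *)
Lemma closed_nontrivial (i j : 'I_r) :
  i != j -> exists2 g, closed_walks g & g <> 1.
Proof.
move=> i_j; exists [~ eval [:: (i, true)], eval [:: (j, true)]].
  exact: shiftR.
move=> /eqP/commgP/(congr1 (fun g => circulation g 0%R i)).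
rewrite !circulationM !circulation_eval !flow_letter sub0r [(_ - _)%R]sub0r.
have -> : (- shift (eval [:: (j, true)]) == 0)%R = false.
  by rewrite oppr_eq0; apply/eqP => /ffunP/(_ j); rewrite shift_letter ffunE.
by rewrite !eqxx (negbTE i_j) andbF.
Qed.

End FreeMetabelian.

Theorem theoremB (r : nat) (hr : 2 <= r) :
  ~ transitive_self_similar (free_metabelian r).
Proof.
apply: (not_self_similar (closed_pure r)).
  exact: (@closed_nontrivial _ (Ordinal (ltnW hr)) (Ordinal hr)).
exact: closed_proper (Ordinal hr).
Qed.
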